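(* Suppose the process is regular. Then under the one-to-one correspondence $x\mapsto\pi^x$ from $P$ onto $\Pi$ (with inverse $\pi\mapsto x_\pi$), the vertices of $P$, or equivalently the basic feasible solutions of (vLP), are mapped to deterministic policies; and conversely, for every deterministic policy $\pi$, $x_\pi$ is a basic feasible solution of (vLP).
   Context: Model (vMDP). Integers $T\geq 2$, $S\ge 1$; states $\mathbb S=\{1,\dots,S\}$; action sets $\mathbb A_s=\{1,\dots,k_s\}$ with $k_s\ge1$ and $k_s>1$ for at least one $s$; transition probabilities $p_t(j|s,a)$ for $t=1,\dots,T-1$, $s,j\in\mathbb S$, $a\in\mathbb A_s$ (nonnegative, summing to 1 over $j$); initial probabilities $\alpha(s)>0$ with $\sum_{s}\alpha(s)=1$. (There are also vector rewards, giving a linear vector objective on $P$, which play no role here.) A policy is $\pi=(\pi_1,\dots,\pi_{T-1})$, where each decision rule $\pi_t$ assigns to each state $s$ a probability distribution $q(\cdot\,|\,s,\pi_t)$ on $\mathbb A_s$; it is deterministic if for all $t,s$ there is $a$ with $q(a|s,\pi_t)=1$. $\Pi$ is the set of all policies. Each $\pi$ induces a probability measure $\mathbb P^\pi$ on trajectories $(\mathbf S_1,\mathbf A_1,\dots,\mathbf S_{T-1},\mathbf A_{T-1},\mathbf S_T)$: $\mathbf S_1$ has law $\alpha$; given the past and $\mathbf S_t=s$, $\mathbf A_t=a$ with probability $q(a|s,\pi_t)$; given the past, $\mathbf S_t=s$ and $\mathbf A_t=a$, $\mathbf S_{t+1}=j$ with probability $p_t(j|s,a)$. Regular process. A state $s$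 is reachable at epoch $t$ under $\pi$ if $\mathbb P^\pi(\mathbf S_t=s|\mathbf S_1=j)>0$ for some $j\in\mathbb S$. The vMDP (process) is regular if every policy reaches every state at every epoch $t=1,\dots,T$. State-action frequencies. For $\pi\in\Pi$, $x_\pi$ has components $x_{\pi,t}(s,a)=\sum_{j}\alpha(j)\mathbb P^\pi(\mathbf S_t=s,\mathbf A_t=a|\mathbf S_1=j)$ for $t=1,\dots,T-1$, and $x_{\pi,T}(s)=\sum_j\alpha(j)\mathbb P^\pi(\mathbf S_T=s|\mathbf S_1=j)$. $P$ is the set of all $x\geqq0$ (componentwise) with components $x_t(s,a)$ ($t\le T-1$, $s\in\mathbb S$, $a\in\mathbb A_s$) and $x_T(s)$ satisfying (a) $\sum_{a\in\mathbb A_j}x_1(j,a)=\alpha(j)$ for all $j$; (b) $\sum_{a\in\mathbb A_j}x_{t+1}(j,a)=\sum_{s}\sum_{a\in\mathbb A_s}p_t(j|s,a)x_t(s,a)$ for all $j$ and $t=1,\dots,T-2$; (c) $x_T(j)=\sum_{s}\sum_{a\in\mathbb A_s}p_{T-1}(j|s,a)x_{T-1}(s,a)$ for all $j$. For $x\in P$, $\pi^x$ is the policy with $q(a|s,\pi^x_t)=x_t(s,a)/\sum_{a'\in\mathbb A_s}x_t(s,a')$ if the denominator is positive, and $q(1|s,\pi^x_t)=1$ otherwise. Basic feasible solutions. Write (a)-(c) as $Ax=b$, with $m=ST$ rows and $n=(T-1)\sum_s k_s+S$ columns, so $P=\{x\in\mathbb R^n:Ax=b,\ x\geqq0\}$ is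 the feasible set of (vLP). A basis is a set $B$ of $m$ column indices such that the submatrix $A_B$ is invertible; the corresponding basic solution has $x_B=A_B^{-1}b$ and all other components zero; it is a basic feasible solution if $x_B\geqq0$. *)

(* Defs.v *)
From HB Require Import structures.
From mathcomp Require Import all_boot all_order all_algebra.

Set Implicit Arguments.
Unset Strict Implicit.
Unset Printing Implicit Defensive.

Import Order.TTheory GRing.Theory Num.Theory.
Local Open Scope ring_scope.

Section StandardForm.

Variables (R : realFieldType) (m n : nat).

(* Vertices are extreme points. *)
Definition vertex (C : 'cV[R]_n -> Prop) (x : 'cV[R]_n) : Prop :=
  C x /\
  forall (y z : 'cV[R]_n) (l : R), C y -> C z -> 0 < l -> l < 1 ->
    x = l *: y + (1 - l) *: z -> y = x /\ z = x.

(* The equation [#|B| = m] lets the columns selected by B form a square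
   matrix; they are listed in the order of [enum B]. *)
Definition basis_col (B : {set 'I_n}) (cB : #|B| = m) (i : 'I_m) : 'I_n :=
  enum_val (cast_ord (esym cB) i).

Definition basis_mx (A : 'M[R]_(m, n)) (B : {set 'I_n}) (cB : #|B| = m)
    : 'M[R]_m :=
  colsub (basis_col cB) A.

Definition basic_solution (A : 'M[R]_(m, n)) (b : 'cV[R]_m) (B : {set 'I_n})
    (cB : #|B| = m) (x : 'cV[R]_n) : Prop :=
  [/\ basis_mx A cB \in unitmx,
      rowsub (basis_col cB) x = invmx (basis_mx A cB) *m b
    & forall i, i \notin B -> x i 0 = 0].

Definition basic_feasible_solution (A : 'M[R]_(m, n)) (b : 'cV[R]_m)
    (x : 'cV[R]_n) : Prop :=
  exists (B : {set 'I_n}) (cB : #|B| = m),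
    basic_solution A b cB x /\ forall i, 0 <= x i 0.

End StandardForm.

(* The horizon is T = N.+2, so that T ranges over all integers >= 2.  All
   indices are shifted to start from 0: epoch t is represented by t - 1, so that
   'I_N.+2 is the set of all epochs and 'I_N.+1 the set of decision epochs
   1, ..., T - 1, and action 1 in state s is represented by 0 : 'I_(k s).
   The vector rewards are omitted. *)
Record vmdp (R : realFieldType) (N S : nat) (k : 'I_S -> nat) := Vmdp {
  trans : 'I_N.+1 -> forall s : 'I_S, 'I_(k s) -> 'I_S -> R;
  init : 'I_S -> R;
  states_gt0 : (0 < S)%N;
  actions_gt0 : forall s, (0 < k s)%N;
  actions_gt1 : exists s, (1 < k s)%N;
  trans_ge0 : forall t s (a : 'I_(k s)) j, 0 <= trans t a j;
  trans_sum1 : forall t s (a : 'I_(k s)), \sum_j trans t a j = 1;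
  init_gt0 : forall s, 0 < init s;
  init_sum1 : \sum_s init s = 1
}.

Section Model.

Variables (R : realFieldType) (N S : nat) (k : 'I_S -> nat).

Definition state_action : finType := {s : 'I_S & 'I_(k s)}.
Definition pair_sa (s : 'I_S) (a : 'I_(k s)) : state_action :=
  Tagged (fun s => 'I_(k s)) a.

(* [q (t, pair_sa a)] is the probability q(a | s, pi_t). *)
Definition kernel := {ffun 'I_N.+1 * state_action -> R}.

Definition is_policy (q : kernel) : Prop :=
  forall t s, (forall a : 'I_(k s), 0 <= q (t, pair_sa a)) /\
              \sum_(a < k s) q (t, pair_sa a) = 1.

Definition deterministic (q : kernel) : Prop :=
  forall t s, exists a : 'I_(k s), q (t, pair_sa a) = 1.

(* (S_1, A_1, ..., S_(T-1), A_(T-1), S_T), with A_t an action available in S_t *)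
Definition trajectory : finType :=
  ({ffun 'I_N.+1 -> state_action} * 'I_S)%type.

(* [unlift ord_max t] is [None] exactly at the final epoch. *)
Definition state_at (w : trajectory) (t : 'I_N.+2) : 'I_S :=
  if unlift ord_max t is Some u then tag (w.1 u) else w.2.

Variable M : vmdp R N k.

(* [lift ord0 t] is the epoch following the decision epoch t. *)
Definition mass (q : kernel) (w : trajectory) : R :=
  init M (state_at w ord0) *
  \prod_(t < N.+1)
    (q (t, w.1 t) * trans M t (tagged (w.1 t)) (state_at w (lift ord0 t))).

Definition prob (q : kernel) (E : pred trajectory) : R :=
  \sum_(w | E w) mass q w.

Definition cond_prob (q : kernel) (E F : pred trajectory) : R :=
  prob q (predI E F) / prob q F.

Definition state_event (t : 'I_N.+2) (s : 'I_S) : pred trajectory :=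
  fun w => state_at w t == s.

Definition state_action_event (t : 'I_N.+1) (sa : state_action)
    : pred trajectory :=
  fun w => w.1 t == sa.

Definition reachable (q : kernel) (t : 'I_N.+2) (s : 'I_S) : Prop :=
  exists j, 0 < cond_prob q (state_event t s) (state_event ord0 j).

Definition regular : Prop :=
  forall q, is_policy q -> forall t s, reachable q t s.

(* The components x_t(s, a), t < T, followed by the components x_T(s) *)
Definition var : finType := ('I_N.+1 * state_action + 'I_S)%type.
Definition constr : finType := ('I_N.+2 * 'I_S)%type.

Definition xsa (x : 'cV[R]_#|var|) (t : 'I_N.+1) (s : 'I_S) (a : 'I_(k s)) : R :=
  x (enum_rank (inl (t, pair_sa a) : var)) 0.
Definition xT (x : 'cV[R]_#|var|) (s : 'I_S) : R :=
  x (enum_rank (inr s : var)) 0.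

Definition freq (q : kernel) : 'cV[R]_#|var| :=
  \col_i match enum_val i with
         | inl (t, sa) => \sum_j init M j *
             cond_prob q (state_action_event t sa) (state_event ord0 j)
         | inr s => \sum_j init M j *
             cond_prob q (state_event ord_max s) (state_event ord0 j)
         end.

Definition in_P (x : 'cV[R]_#|var|) : Prop :=
  [/\ forall i, 0 <= x i 0,
      forall j, \sum_(a < k j) xsa x ord0 a = init M j,
      forall t u : 'I_N.+1, u = t.+1 :> nat -> forall j,
        \sum_(a < k j) xsa x u a =
        \sum_s \sum_(a < k s) trans M t a j * xsa x t a
    & forall j, xT x j =
        \sum_s \sum_(a < k s) trans M ord_max a j * xsa x ord_max a].

Definition policy_of (x : 'cV[R]_#|var|) : kernel :=
  [ffun c : 'I_N.+1 * state_action =>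
     let: (t, sa) := c in
     let total := \sum_(a < k (tag sa)) xsa x t a in
     if 0 < total then xsa x t (tagged sa) / total
     else (tagged sa == 0 :> nat)%:R].

(* Constraints (a)-(c) in the form A x = b, the constraint for the state j at
   epoch t being (t, j), with the inflow from epoch t - 1 moved to the left. *)
Definition lp_coef (c : constr) (v : var) : R :=
  match v with
  | inl (t, sa) =>
      ((c.1 == t :> nat) && (c.2 == tag sa))%:R
      - (c.1 == t.+1 :> nat)%:R * trans M t (tagged sa) c.2
  | inr s => ((c.1 == ord_max) && (c.2 == s))%:R
  end.

Definition lp_mx : 'M[R]_(#|constr|, #|var|) :=
  \matrix_(i, j) lp_coef (enum_val i) (enum_val j).

Definition lp_rhs : 'cV[R]_#|constr| :=
  \col_i (let: (t, j) := (enum_val i : constr) in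
          if t == ord0 then init M j else 0).

Lemma card_constr : #|constr| = (S * N.+2)%N.
Proof. by rewrite card_prod !card_ord mulnC. Qed.

Lemma card_var : #|var| = (N.+1 * (\sum_s k s) + S)%N.
Proof.
rewrite card_sum card_prod !card_ord card_tagged sumnE big_map big_enum /=.
by under eq_bigr do rewrite card_ord.
Qed.

Lemma sum_state_action (F : state_action -> R) :
  \sum_sa F sa = \sum_s \sum_(a < k s) F (pair_sa a).
Proof.
rewrite (sig_big_dep (fun=> true) (fun _ _ => true)
          (fun s (a : 'I_(k s)) => F (pair_sa a))) /=.
by apply: eq_bigr => -[].
Qed.

Lemma lp_mxE (x : 'cV[R]_#|var|) (t : 'I_N.+2) (j : 'I_S) :
  (lp_mx *m x) (enum_rank ((t, j) : constr)) 0 =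
  \sum_(u < N.+1) ((t == u :> nat)%:R * \sum_(a < k j) xsa x u a
     - (t == u.+1 :> nat)%:R *
       \sum_s \sum_(a < k s) trans M u a j * xsa x u a)
  + (t == ord_max)%:R * xT x j.
Proof.
rewrite mxE (reindex_onto (@enum_rank var) enum_val) /=; last first.
  by move=> i _; rewrite enum_valK.
under eq_bigl do rewrite enum_rankK eqxx.
under eq_bigr do rewrite mxE !enum_rankK.
rewrite big_sumType /=; congr (_ + _); last first.
  rewrite (bigD1 j) //= eqxx andbT big1 ?addr0 // => s sj.
  by rewrite [j == s]eq_sym (negPf sj) andbF mul0r.
transitivity (\sum_(u < N.+1) \sum_sa lp_coef (t, j) (inl (u, sa)) *
                x (enum_rank (inl (u, sa) : var)) 0).
  by rewrite pair_bigA; apply: eq_bigr => -[].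
apply: eq_bigr => u _; rewrite sum_state_action /=.
under eq_bigr => s _ do under eq_bigr => a _ do rewrite mulrBl.
under eq_bigr => s _ do rewrite sumrB.
rewrite sumrB; congr (_ - _).
  rewrite (bigD1 j) //= [X in _ + X]big1 ?addr0 => [|s sj].
    by rewrite mulr_sumr; apply: eq_bigr => a _; rewrite eqxx andbT.
  by apply: big1 => a _; rewrite [j == s]eq_sym (negPf sj) andbF mul0r.
rewrite mulr_sumr; apply: eq_bigr => s _; rewrite mulr_sumr.
by apply: eq_bigr => a _; rewrite mulrA.
Qed.

Lemma in_P_lp (x : 'cV[R]_#|var|) :
  in_P x <-> lp_mx *m x = lp_rhs /\ forall i, 0 <= x i 0.
Proof.
have first_row j : (lp_mx *m x) (enum_rank ((ord0, j) : constr)) 0 =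
    \sum_(a < k j) xsa x ord0 a.
  rewrite lp_mxE mul0r addr0 big_ord_recl /= mul1r mul0r subr0.
  by rewrite [X in _ + X]big1 ?addr0 // => u _; rewrite !mul0r subr0.
have mid_row (t u : 'I_N.+1) j : u = t.+1 :> nat ->
    (lp_mx *m x) (enum_rank ((widen_ord (leqnSn _) u, j) : constr)) 0 =
    \sum_(a < k j) xsa x u a -
    \sum_s \sum_(a < k s) trans M t a j * xsa x t a.
  move=> ut; rewrite lp_mxE -[_ == ord_max]val_eqE /= ltn_eqF // mul0r addr0.
  rewrite sumrB (bigD1 u) //= eqxx mul1r [X in _ + X - _]big1 ?addr0; last first.
    by move=> v vu; rewrite [_ == _ :> nat]eq_sym val_eqE (negPf vu) mul0r.
  congr (_ - _); rewrite (bigD1 t) //= ut eqxx mul1r [X in _ + X]big1 ?addr0 // => v vt.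
  by rewrite eqSS [_ == _ :> nat]eq_sym val_eqE (negPf vt) mul0r.
have last_row j : (lp_mx *m x) (enum_rank ((ord_max, j) : constr)) 0 =
    xT x j - \sum_s \sum_(a < k s) trans M ord_max a j * xsa x ord_max a.
  rewrite lp_mxE eqxx mul1r addrC; congr (_ + _).
  rewrite big_ord_recr /= big1 ?add0r => [|u _].
    by rewrite eqxx mul1r gtn_eqF // mul0r sub0r.
  rewrite gtn_eqF; last by rewrite ltnS ltnW.
  by rewrite gtn_eqF ?ltnS // !mul0r subr0.
have rhsE t j : lp_rhs (enum_rank ((t, j) : constr)) 0 =
    if t == ord0 then init M j else 0.
  by rewrite mxE enum_rankK.
split=> [[x0 Pa Pb Pc]|[Ax x0]]; split=> //.
- apply/matrixP => i z; rewrite {z}ord1 -[i]enum_valK.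
  case: (enum_val i) => t j; rewrite rhsE.
  case: (unliftP ord0 t) => [v ->|->]; last by rewrite first_row eqxx Pa.
  case: (unliftP ord_max v) => [w vw|->]; last first.
    have -> : lift ord0 ord_max = ord_max :> 'I_N.+2 by apply: val_inj.
    by rewrite last_row Pc subrr.
  have wN := ltn_ord w; pose u : 'I_N.+1 := Ordinal (wN : (w.+1 < N.+1)%N).
  have -> : lift ord0 v = widen_ord (leqnSn _) u.
    by apply: val_inj; rewrite vw /= /bump /= leqNgt wN.
  have uv : u = v.+1 :> nat by rewrite vw /= /bump leqNgt wN.
  by rewrite (mid_row v) // (Pb v) // subrr.
- by move=> j; rewrite -first_row Ax rhsE eqxx.
- move=> t u ut j; apply/eqP; rewrite -subr_eq0 -(mid_row t) // Ax rhsE.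
  by rewrite -val_eqE /= ut.
by move=> j; apply/eqP; rewrite -subr_eq0 -last_row Ax rhsE.
Qed.

End Model.

(* Main.v *)
Require Import Defs.
From mathcomp Require Import all_boot all_order all_algebra.
From mathcomp Require Import ring lra.

Set Implicit Arguments.
Unset Strict Implicit.
Unset Printing Implicit Defensive.

Import Order.TTheory GRing.Theory Num.Theory.
Local Open Scope ring_scope.

(** Under a policy [q] the state process is a Markov chain.  Its marginal
    [occupancy M q] satisfies a forward recursion, and the probability of state [s]
    and action [a] at epoch [t] is [occupancy M q t s * q (t, pair_sa a)]
    ([prob_state], [prob_state_action]).  The constraints defining [P] are that
    same recursion written for the products, so [freq M q] lies in [P], and
    conversely a point of [P] is recovered from its total mass in each state, which
    the recursion determines, and from the proportions [policy_of] in which each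
    total is split among the actions ([policy_ofK]).  Regularity makes all totals
    positive ([occupancy_gt0]), so the proportions can also be read back from the
    frequencies ([freqK]).

    The occupancies being positive, [freq M q] vanishes exactly where [q] does.
    This turns the extreme point question into one about supports.

    If [q] is deterministic, and [freq M q] is a convex combination of two points
    of [P], both vanish where [freq M q] does; their policies only use the actions
    of [q], hence equal [q], and the two points are [freq M q]
    ([deterministic_vertex]).

    Conversely let [x] be a vertex and [d] a deterministic policy using only
    actions of positive probability under [policy_of x].  Then [x] dominates a
    positive multiple of [freq M d], so [x] is a proper convex combination of
    [freq M d] and another point of [P]; being extreme, [x] is [freq M d], and its
    policy is [d] ([vertex_deterministic]).

    It remains to compare vertices and basic feasible solutions.  A basic feasible
    solution is always a vertex ([bfs_vertex]).  By the above, a vertex of [P] has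
    one positive coordinate for each state and epoch, which is the number of
    constraints, and a vertex with that many nonzero coordinates is basic, its
    support being the basis ([nondegenerate_vertex_bfs]). *)

(** * Vertices and basic feasible solutions of a linear program *)

Lemma uniform_lower_bound (R : realFieldType) (I : finType) (F : I -> R) :
  (forall i, 0 < F i) ->
  exists c, [/\ 0 < c, c < 1 & forall i, c <= F i].
Proof.
move=> F0; exists (\big[Order.min/2^-1]_i F i); split.
- by apply/bigmin_gtP; split=> //; lra.
- by apply: le_lt_trans (bigmin_le_id _ _ _ _) _; lra.
by move=> i; apply: bigmin_le.
Qed.

Lemma conv_comb_eq0 (R : realFieldType) (l a b : R) : 0 < l -> l < 1 ->
  0 <= a -> 0 <= b -> l * a + (1 - l) * b = 0 -> a = 0 /\ b = 0.
Proof.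
move=> l0 l1 a0 b0 /eqP; rewrite -subr_gt0 in l1.
rewrite paddr_eq0 ?mulr_ge0 ?(ltW l0) ?(ltW l1) // !mulf_eq0.
by rewrite (gt_eqF l0) (gt_eqF l1) /= => /andP[/eqP -> /eqP ->].
Qed.

Section LinearProgram.

Variables (R : realFieldType) (m n : nat) (A : 'M[R]_(m, n)) (b : 'cV[R]_m).
Implicit Types (x y z : 'cV[R]_n) (B : {set 'I_n}).

Definition feasible x : Prop := A *m x = b /\ forall i, 0 <= x i 0.

Lemma basis_col_surj B (cB : #|B| = m) i :
  i \in B -> exists l, i = basis_col cB l.
Proof.
move=> iB; exists (cast_ord cB (enum_rank_in iB i)).
by rewrite /basis_col cast_ordK enum_rankK_in.
Qed.

(** With a point supported on [B], the system [A x = b] is square. *)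
Lemma basis_mulmx B (cB : #|B| = m) x : (forall i, i \notin B -> x i 0 = 0) ->
  A *m x = basis_mx A cB *m rowsub (basis_col cB) x.
Proof.
move=> xB; apply/matrixP => r j; rewrite {j}ord1 !mxE.
rewrite (bigID (mem B)) /= [X in _ + X]big1 ?addr0; last first.
  by move=> i iB; rewrite xB ?mulr0.
rewrite big_enum_val (reindex (cast_ord (esym cB))) /=; last first.
  by exists (cast_ord cB) => i _; rewrite ?cast_ordK ?cast_ordKV.
by apply: eq_bigr => i _; rewrite !mxE.
Qed.

(** A convex combination of nonnegative points vanishes only where both points do,
    so the two points are supported on the basis as well, and the invertible
    square system determines them. *)
Lemma bfs_vertex x : basic_feasible_solution A b x -> vertex feasible x.
Proof.
case=> B [cB [[uB xB x0] x_ge0]].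
have feas_x : feasible x by split; rewrite // (basis_mulmx cB) // xB mulKVmx.
split=> // y z l [Ay y0] [Az z0] l0 l1 xyz.
have uniq y' : A *m y' = b -> (forall i, i \notin B -> y' i 0 = 0) -> y' = x.
  move=> Ay' y'0; apply/matrixP => i j; rewrite {j}ord1.
  have [iB|iB] := boolP (i \in B); last by rewrite y'0 ?x0.
  have [r ->] := basis_col_surj cB iB.
  have /matrixP/(_ r 0) : rowsub (basis_col cB) y' = rowsub (basis_col cB) x.
    by rewrite xB -Ay' (basis_mulmx cB y'0) mulKmx.
  by rewrite !mxE.
have yz0 i : i \notin B -> y i 0 = 0 /\ z i 0 = 0.
  by move=> /x0; rewrite xyz !mxE; apply: conv_comb_eq0.
by split; apply: uniq => // i /yz0 [].
Qed.

(** The support [B] of [x] has the right size for a basis.  A nonzero kernel vector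
    of the columns in [B] would extend by zero to a direction [y] along which [x]
    can be moved both ways inside the feasible set, its coordinates in [B] being
    positive; then [x] would be the midpoint of a feasible segment. *)
Lemma nondegenerate_vertex_bfs x :
  vertex feasible x -> #|[set i | x i 0 != 0]| = m ->
  basic_feasible_solution A b x.
Proof.
case=> [[Ax x_ge0] ext] cB; set B := [set i | _] in cB.
have x0 i : i \notin B -> x i 0 = 0 by rewrite inE negbK => /eqP.
exists B, cB; split=> //.
suff uB : basis_mx A cB \in unitmx.
  by split=> //; rewrite -Ax (basis_mulmx cB x0) mulKmx.
suff inj (u : 'cV_m) : basis_mx A cB *m u = 0 -> u = 0.
  rewrite -unitmx_tr -row_free_unit -kermx_eq0; apply/eqP/row_matrixP => r.
  apply: trmx_inj; rewrite row0 trmx0; apply: inj.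
  by rewrite -{1}[basis_mx A cB]trmxK -trmx_mul -row_mul mulmx_ker row0 trmx0.
move=> Au.
(* The vector u extended by zero outside B: the sum has at most one term. *)
pose y : 'cV[R]_n := \col_i \sum_(l | basis_col cB l == i) u l 0.
have y0 i : i \notin B -> y i 0 = 0.
  move=> iB; rewrite mxE big1 // => l /eqP li; case/negP: iB.
  by rewrite -li enum_valP.
have yu : rowsub (basis_col cB) y = u.
  apply/matrixP => l j; rewrite {j}ord1 !mxE (big_pred1 l) // => l'.
  by rewrite /= /basis_col (inj_eq enum_val_inj) (inj_eq (@cast_ord_inj _ _ _)).
clearbody y; have Ay : A *m y = 0 by rewrite (basis_mulmx cB y0) yu.
have [e e0 xey] : exists2 e : R, 0 < e & forall i, e * `|y i 0| <= x i 0.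
  (* Adding 1 keeps the quotient defined where y vanishes. *)
  pose F i := if i \in B then x i 0 / (1 + `|y i 0|) else 1.
  have y1 i : 0 < 1 + `|y i 0| by rewrite ltr_pwDl.
  have [i|e [e0 _ eF]] := @uniform_lower_bound _ _ F.
    rewrite /F; case: ifP => //; rewrite inE => xi.
    by rewrite divr_gt0 // lt_def xi x_ge0.
  exists e => // i; have := eF i; rewrite /F.
  case: ifP => [_|/negbT/y0 ->]; last by rewrite normr0 mulr0.
  by rewrite ler_pdivlMr // mulrDr mulr1; lra.
have feas s : `|s| = 1 -> feasible (x + (s * e) *: y).
  move=> s1; split; first by rewrite mulmxDr -scalemxAr Ay scaler0 addr0.
  move=> i; rewrite !mxE; have := xey i.
  have : `|s * e * y i 0| <= e * `|y i 0|.
    by rewrite !normrM s1 mul1r (gtr0_norm e0).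
  rewrite ler_norml => /andP[]; lra.
have [] := ext _ _ 2^-1 (feas 1 _) (feas (-1) _) _ _ _.
- by rewrite normr1.
- by rewrite normrN1.
- by lra.
- by lra.
- by apply/matrixP => i j; rewrite !mxE; field.
move=> /(congr1 (fun v => v - x)); rewrite mul1r addrAC subrr add0r => /eqP.
rewrite scaler_eq0 (gt_eqF e0) /= => /eqP ye _.
by rewrite -yu ye; apply/matrixP => i j; rewrite !mxE.
Qed.

End LinearProgram.

(** * Policies *)

Section Policies.

Variables (R : realFieldType) (N S : nat) (k : 'I_S -> nat).
Implicit Types (q : kernel R N k).

Lemma policy_ge0 q v : is_policy q -> 0 <= q v.
Proof. by case: v => t [s a] qP; have [+ _] := qP t s => /(_ a). Qed.

Lemma policy_sum1 q t s : is_policy q -> \sum_(a < k s) q (t, pair_sa a) = 1.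
Proof. by move=> qP; have [] := qP t s. Qed.

Lemma policy_eq0 q t (s : 'I_S) (a c : 'I_(k s)) : is_policy q ->
  q (t, pair_sa a) = 1 -> c != a -> q (t, pair_sa c) = 0.
Proof.
move=> qP qa ca; have := policy_sum1 t s qP; rewrite (bigD1 a) //= qa => /eqP.
rewrite -subr_eq0 addrAC subrr add0r => /eqP q0.
by apply: (psumr_eq0P _ q0) => // *; apply: policy_ge0.
Qed.

Lemma deterministicE q t (x : state_action k) :
  is_policy q -> deterministic q ->
  q (t, x) = (q (t, x) != 0)%:R.
Proof.
case: x => s c qP /(_ t s) [a qa]; rewrite -[existT _ _ _]/(pair_sa c).
have [->|ca] := eqVneq c a; first by rewrite qa oner_eq0.
by rewrite (policy_eq0 qP qa ca) eqxx.
Qed.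

(** A policy that avoids every action avoided by a deterministic one has a single
    action left in each state. *)
Lemma eq_deterministic q q' : is_policy q -> is_policy q' -> deterministic q ->
  (forall v, q v = 0 -> q' v = 0) -> q' = q.
Proof.
move=> qP q'P qD sub; apply/ffunP => -[t [s c]].
rewrite -[existT _ _ _]/(pair_sa c).
have [q0|q1] := eqVneq (q (t, pair_sa c)) 0; first by rewrite q0 sub.
have [a qa] := qD t s.
have ca : c = a by apply/eqP; apply: contraNT q1 => /(policy_eq0 qP qa) ->.
rewrite ca [RHS]qa -(policy_sum1 t s q'P) (bigD1 a) //= big1 ?addr0 //.
by move=> e /(policy_eq0 qP qa) /sub.
Qed.

(** In each state at each epoch some action has positive probability under [q];
    [d] picks one of them.  Scaled down far enough, [d] then lies below [q]: this is
    what puts [freq M d] on the smallest face of [P] containing [freq M q]. *)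
Lemma dominated_deterministic q : is_policy q ->
  exists d c, [/\ is_policy d, deterministic d, 0 < c, c < 1
                & forall v, c * d v <= q v].
Proof.
move=> qP; have likely t s : exists a : 'I_(k s), 0 < q (t, pair_sa a).
  apply/existsP; apply: contraT => /existsPn q0.
  have := @ltr01 R; rewrite -(policy_sum1 t s qP) ltNge sumr_le0 // => a _.
  by rewrite leNgt.
pose act t s := xchoose (likely t s).
pose d : kernel R N k := [ffun v => (tagged v.2 == act v.1 (tag v.2))%:R].
have dE t s (a : 'I_(k s)) : d (t, pair_sa a) = (a == act t s)%:R.
  by rewrite ffunE.
have [v|c [c0 c1 cq]] := @uniform_lower_bound R _
  (fun v : 'I_N.+1 * 'I_S => q (v.1, pair_sa (act v.1 v.2))).
  exact: (xchooseP (likely v.1 v.2)).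
exists d, c; split=> //.
- move=> t s; split=> [a|]; first by rewrite dE ler0n.
  rewrite (bigD1 (act t s)) //= dE eqxx big1 ?addr0 // => a.
  by rewrite dE => /negPf ->.
- by move=> t s; exists (act t s); rewrite dE eqxx.
move=> [t [s a]]; rewrite -[existT _ _ _]/(pair_sa a) dE.
case: eqP => [->|_]; first by rewrite mulr1; apply: (cq (t, s)).
by rewrite mulr0 policy_ge0.
Qed.

End Policies.

(** * Marginals of the trajectory measure *)

Section PathMeasure.

Variables (R : realFieldType) (N S : nat) (k : 'I_S -> nat) (M : vmdp R N k).
Local Notation T := (state_action k).

Definition extend n (w : {ffun 'I_n -> T}) (x : T) : {ffun 'I_n.+1 -> T} :=
  [ffun i => if unlift ord_max i is Some j then w j else x].

(** Peels off the last step of a path; the sums over trajectories below are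
    computed by induction on their length through it. *)
Lemma sum_extend n (F : {ffun 'I_n.+1 -> T} -> R) :
  \sum_w F w = \sum_w \sum_x F (extend w x).
Proof.
rewrite pair_bigA (reindex (fun p => extend p.1 p.2)) //=.
exists (fun w => ([ffun j => w (lift ord_max j)], w ord_max)) => [[w x]|w] _.
  congr pair; last by rewrite ffunE unlift_none.
  by apply/ffunP => j; rewrite !ffunE liftK.
by apply/ffunP => i; rewrite ffunE; case: unliftP => [j|] -> //; rewrite ffunE.
Qed.

(** [state_at] for a path of any length [n], including the empty path, which is
    where the inductions start. *)
Definition stage n (w : {ffun 'I_n -> T}) (s : 'I_S) (t : 'I_n.+1) : 'I_S :=
  if unlift ord_max t is Some u then tag (w u) else s.

Lemma stage_extend n (w : {ffun 'I_n -> T}) x j (t : 'I_n.+1) :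
  stage (extend w x) j (lift ord_max t) = stage w (tag x) t.
Proof. by rewrite /stage liftK ffunE; case: unlift. Qed.

Variable q : kernel R N k.

(** For [n = N.+1] this is [mass M q].  The kernels are indexed by [inord t] so that
    the length [n] can vary while [q] and [M] stay fixed. *)
Definition path_mass n (w : {ffun 'I_n -> T}) (s : 'I_S) : R :=
  init M (stage w s ord0) *
  \prod_(t < n) (q (inord t, w t) *
    trans M (inord t) (tagged (w t)) (stage w s (lift ord0 t))).

Lemma path_mass_extend n (w : {ffun 'I_n -> T}) x j :
  path_mass (extend w x) j =
  path_mass w (tag x) * (q (inord n, x) * trans M (inord n) (tagged x) j).
Proof.
rewrite /path_mass big_ord_recr /= mulrA; congr (_ * _ * _).
- have -> : ord0 = lift ord_max ord0 :> 'I_n.+2 by apply: val_inj.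
  by rewrite stage_extend.
- apply: eq_bigr => t _.
  have -> : lift ord0 (widen_ord (leqnSn n) t) = lift ord_max (lift ord0 t).
    by apply: val_inj; rewrite /= /bump /= leqNgt !ltnS ltn_ord.
  have -> : widen_ord (leqnSn n) t = lift ord_max t.
    by apply: val_inj; rewrite /= /bump /= leqNgt ltn_ord.
  by rewrite stage_extend ffunE liftK.
have -> : lift ord0 ord_max = ord_max :> 'I_n.+2 by apply: val_inj.
by rewrite /stage ffunE !unlift_none.
Qed.

(** The law of the state at epoch [n], computed by the forward Kolmogorov
    equation. *)
Fixpoint occupancy (n : nat) (s : 'I_S) : R :=
  if n is n'.+1 then
    \sum_(x : T) occupancy n' (tag x) *
      (q (inord n', x) * trans M (inord n') (tagged x) s)
  else init M s.

Lemma sum_path_mass n s :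
  \sum_(w : {ffun 'I_n -> T}) path_mass w s = occupancy n s.
Proof.
elim: n s => [|n IH] s /=.
  rewrite (big_pred1 [ffun=> pair_sa (Ordinal (actions_gt0 M s))]).
    by rewrite /path_mass big_ord0 mulr1 /stage; case: unliftP => // -[].
  by move=> w; apply/esym/eqP/ffunP => -[].
rewrite sum_extend exchange_big; apply: eq_bigr => x _ /=.
by rewrite -IH mulr_suml; apply: eq_bigr => w _; rewrite path_mass_extend.
Qed.

Hypothesis qP : is_policy q.

Lemma sum_policy t (F : 'I_S -> R) :
  \sum_(x : T) F (tag x) * q (t, x) = \sum_s F s.
Proof.
rewrite sum_state_action; apply: eq_bigr => s _.
rewrite -[LHS]/(\sum_(a < k s) F s * q (t, pair_sa a)).
by rewrite -mulr_sumr policy_sum1 ?mulr1.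
Qed.

(** The steps after epoch [t] are summed out one at a time, from the last one: each
    contributes a factor 1 because [q] and the transition kernel are stochastic. *)
Lemma sum_path_mass_action n (t : 'I_n) x :
  \sum_(w : {ffun 'I_n -> T} | w t == x) \sum_s path_mass w s =
  occupancy t (tag x) * q (inord t, x).
Proof.
elim: n t => [|n IH] t; first by case: t.
rewrite big_mkcond sum_extend /=.
have sum_last (w : {ffun 'I_n -> T}) y : \sum_s path_mass (extend w y) s =
    path_mass w (tag y) * q (inord n, y).
  under eq_bigr do rewrite path_mass_extend mulrA.
  by rewrite -mulr_sumr trans_sum1 mulr1.
case: (unliftP ord_max t) => [u ->|->]; last first.
  rewrite -sum_path_mass mulr_suml; apply: eq_bigr => w _.
  rewrite -big_mkcond (big_pred1 x) ?sum_last // => y.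
  by rewrite ffunE unlift_none.
rewrite lift_max -IH [RHS]big_mkcond; apply: eq_bigr => w _.
rewrite -big_mkcond; under eq_bigl do rewrite ffunE liftK.
case: (w u == x); last by rewrite big_pred0_eq.
by under eq_bigr do rewrite sum_last; rewrite sum_policy.
Qed.

Lemma prob_state_action t x :
  prob M q (state_action_event t x) = occupancy t (tag x) * q (t, x).
Proof.
rewrite -[in q _](inord_val t) -sum_path_mass_action pair_big_dep /=.
rewrite /prob; apply: eq_big => [[w s]|[w s] _]; first by rewrite /= andbT.
by congr (_ * _); apply: eq_bigr => u _; rewrite inord_val.
Qed.

Lemma prob_state t s : prob M q (state_event t s) = occupancy t s.
Proof.
case: (unliftP ord_max t) => [u ->|->].
  rewrite lift_max.
  transitivity (\sum_(x : T | tag x == s) prob M q (state_action_event u x)).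
    rewrite /prob (partition_big (fun w : trajectory N k => w.1 u)
                    (fun x => tag x == s)) /=.
      apply: eq_bigr => x /eqP xs; apply: eq_bigl => w.
      rewrite /state_event /state_at liftK /state_action_event.
      by have [->|] := eqVneq (w.1 u) x; rewrite ?xs ?eqxx ?andbF.
    by move=> w; rewrite /state_event /state_at liftK.
  under eq_bigr do rewrite prob_state_action.
  transitivity (\sum_(x : T) (tag x == s)%:R * occupancy u (tag x) * q (u, x)).
    rewrite big_mkcond; apply: eq_bigr => x _.
    by case: ifP => _; rewrite ?mul1r ?mul0r.
  rewrite (sum_policy u (fun r => (r == s)%:R * occupancy u r)).
  rewrite (bigD1 s) //= eqxx mul1r big1 ?addr0 // => r /negPf ->.
  by rewrite mul0r.
rewrite -sum_path_mass /prob.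
transitivity (\sum_(w : {ffun 'I_N.+1 -> T})
  \sum_(r | r == s) path_mass w r); last first.
  by apply: eq_bigr => w _; rewrite big_pred1_eq.
rewrite pair_big_dep /=; apply: eq_big => [[w r]|[w r] _].
  by rewrite /state_event /state_at unlift_none.
by congr (_ * _); apply: eq_bigr => u _; rewrite inord_val.
Qed.

(** The conditional probabilities are well defined since every initial state has
    positive probability. *)
Lemma total_prob E :
  \sum_j init M j * cond_prob M q E (state_event ord0 j) = prob M q E.
Proof.
rewrite [RHS](partition_big (fun w => state_at w ord0) predT) //=.
apply: eq_bigr => j _; rewrite /cond_prob prob_state /= mulrC divfK //.
by rewrite gt_eqF ?init_gt0.
Qed.

Lemma freq_action t x :
  freq M q (enum_rank (inl (t, x) : var N k)) 0 =
  occupancy t (tag x) * q (t, x).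
Proof. by rewrite mxE enum_rankK total_prob prob_state_action. Qed.

Lemma freq_last s :
  freq M q (enum_rank (inr s : var N k)) 0 = occupancy N.+1 s.
Proof. by rewrite mxE enum_rankK total_prob prob_state. Qed.

Lemma occupancy_ge0 n s : 0 <= occupancy n s.
Proof.
elim: n s => [|n IH] s /=; first by rewrite ltW ?init_gt0.
by rewrite sumr_ge0 // => x _; rewrite !mulr_ge0 ?policy_ge0 ?trans_ge0.
Qed.

Lemma occupancy_gt0 (t : 'I_N.+2) s : regular M -> 0 < occupancy t s.
Proof.
move=> /(_ q qP t s) [j]; apply: contraTT; rewrite -!leNgt => ts0.
have mass_ge0 w : 0 <= mass M q w.
  rewrite mulr_ge0 ?(ltW (init_gt0 _ _)) // prodr_ge0 // => u _.
  by rewrite mulr_ge0 ?policy_ge0 ?trans_ge0.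
rewrite /cond_prob prob_state pmulr_lle0 ?invr_gt0 ?init_gt0 //.
apply: le_trans ts0; rewrite -prob_state /prob big_mkcondr /=.
by apply: ler_sum => w _; case: ifP.
Qed.

End PathMeasure.

(** * Policies and points of P *)

Section Correspondence.

Variables (R : realFieldType) (N S : nat) (k : 'I_S -> nat) (M : vmdp R N k).
Implicit Types (q : kernel R N k) (x y : 'cV[R]_#|var N k|).

Lemma var_vecP x y :
  (forall t (s : 'I_S) (a : 'I_(k s)), xsa x t a = xsa y t a) ->
  (forall s, xT x s = xT y s) -> x = y.
Proof.
move=> xy_sa xy_T; apply/matrixP => i j; rewrite {j}ord1 -[i]enum_valK.
by case: (enum_val i) => [[t [s a]]|s]; [apply: xy_sa|apply: xy_T].
Qed.

Lemma xsa_freq q t (s : 'I_S) (a : 'I_(k s)) : is_policy q ->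
  xsa (freq M q) t a = occupancy M q t s * q (t, pair_sa a).
Proof. by move=> qP; rewrite /xsa freq_action. Qed.

Lemma xT_freq q s : is_policy q -> xT (freq M q) s = occupancy M q N.+1 s.
Proof. by move=> qP; rewrite /xT freq_last. Qed.

Lemma sum_xsa_freq q t s : is_policy q ->
  \sum_(a < k s) xsa (freq M q) t a = occupancy M q t s.
Proof.
move=> qP; under eq_bigr do rewrite xsa_freq //.
by rewrite -mulr_sumr policy_sum1 ?mulr1.
Qed.

Lemma freq_in_P q : is_policy q -> in_P M (freq M q).
Proof.
move=> qP; have flow (t : 'I_N.+1) j : occupancy M q t.+1 j =
    \sum_s \sum_(a < k s) trans M t a j * xsa (freq M q) t a.
  rewrite /= sum_state_action inord_val; apply: eq_bigr => s _.
  by apply: eq_bigr => a _; rewrite xsa_freq // mulrA mulrC.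
split=> [i|j|t u ut j|j].
- rewrite -[i]enum_valK; case: (enum_val i) => [[t x]|s].
    by rewrite freq_action // mulr_ge0 ?occupancy_ge0 ?policy_ge0.
  by rewrite freq_last ?occupancy_ge0.
- by rewrite sum_xsa_freq.
- by rewrite sum_xsa_freq // ut flow.
by rewrite xT_freq // -flow.
Qed.

(** Where the total is zero the division is not available, but then all its
    nonnegative terms vanish and the identity still holds. *)
Lemma policy_ofE x t (s : 'I_S) (a : 'I_(k s)) : (forall i, 0 <= x i 0) ->
  xsa x t a = (\sum_(c < k s) xsa x t c) * policy_of x (t, pair_sa a).
Proof.
move=> x0; rewrite ffunE /=; case: ifP => [pos|].
  by rewrite mulrC divfK ?gt_eqF.
have ge0 (c : 'I_(k s)) : true -> 0 <= xsa x t c by move=> _; apply: x0.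
rewrite lt_def sumr_ge0 // andbT => /negbFE/eqP tot0; rewrite tot0 mul0r.
by apply: (psumr_eq0P ge0 tot0).
Qed.

Lemma policy_of_policy x : in_P M x -> is_policy (policy_of x).
Proof.
case=> x0 _ _ _ t s; split=> [a|].
  rewrite ffunE /=; case: ifP => // pos.
  by rewrite divr_ge0 ?(ltW pos) //; apply: x0.
under eq_bigr do rewrite ffunE /=.
case: (boolP (0 < \sum_(a < k s) xsa x t a)) => [pos|_].
  by rewrite -mulr_suml divff ?gt_eqF.
rewrite (bigD1 (Ordinal (actions_gt0 M s))) //= big1 ?addr0 // => a.
by rewrite -val_eqE /= => /negPf ->.
Qed.

(** The totals of [x] over the actions and the occupancies of [policy_of x] obey the
    same recursion from the same initial law, so they agree. *)
Lemma policy_ofK x : in_P M x -> freq M (policy_of x) = x.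
Proof.
move=> xP; have qP := policy_of_policy xP; have [x0 Pa Pb Pc] := xP.
have step (t : 'I_N.+1) :
    (forall s, \sum_(a < k s) xsa x t a = occupancy M (policy_of x) t s) ->
    forall j, occupancy M (policy_of x) t.+1 j =
              \sum_s \sum_(a < k s) trans M t a j * xsa x t a.
  move=> tE j; rewrite /= sum_state_action inord_val; apply: eq_bigr => s _.
  by apply: eq_bigr => a _; rewrite policy_ofE // tE mulrA mulrC.
have total (t : 'I_N.+1) s :
    \sum_(a < k s) xsa x t a = occupancy M (policy_of x) t s.
  case: t => t; elim: t s => [|t IH] s tN.
    by have -> : Ordinal tN = ord0 by [apply: val_inj]; rewrite Pa.
  have tN' : (t < N.+1)%N by apply: ltnW.
  by rewrite (Pb (Ordinal tN')) // (step (Ordinal tN')) // => r; apply: IH.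
apply: var_vecP => [t s a|s].
  by rewrite xsa_freq // -total -policy_ofE.
by rewrite xT_freq // Pc -(step ord_max).
Qed.

Lemma occupancy_dominated q d c n s : is_policy d -> 0 <= c ->
  (forall v, c * d v <= q v) ->
  c ^+ n * occupancy M d n s <= occupancy M q n s.
Proof.
move=> dP c0 cq; elim: n s => [|n IH] s /=; first by rewrite mul1r.
rewrite mulr_sumr; apply: ler_sum => x _.
rewrite [leRHS]mulrA [X in _ ^+ _ * X]mulrA mulrA ler_wpM2r ?trans_ge0 //.
rewrite exprSr mulrACA.
by rewrite ler_pM ?mulr_ge0 ?exprn_ge0 ?occupancy_ge0 ?policy_ge0.
Qed.

Lemma vertex_in_P x :
  vertex (in_P M) x <-> vertex (feasible (lp_mx M) (lp_rhs M)) x.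
Proof.
by split=> -[/in_P_lp xP ext]; split=> // y z l /in_P_lp yP /in_P_lp zP;
  apply: ext.
Qed.

Hypothesis Mregular : regular M.

Lemma decision_occupancy_gt0 q (t : 'I_N.+1) s :
  is_policy q -> 0 < occupancy M q t s.
Proof.
move=> qP; have := occupancy_gt0 qP (lift ord_max t) s Mregular.
by rewrite lift_max.
Qed.

Lemma freqK q : is_policy q -> policy_of (freq M q) = q.
Proof.
move=> qP; apply/ffunP => -[t [s a]]; rewrite ffunE /= sum_xsa_freq //.
have pos := decision_occupancy_gt0 t s qP.
by rewrite pos xsa_freq // mulrC mulKf // gt_eqF.
Qed.

(** * Vertices and deterministic policies *)

(** The entries of a deterministic policy are 0 or 1, so the number of nonzero
    ones is their sum: 1 for each state and decision epoch.  The final epoch adds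
    one nonzero coordinate per state. *)
Lemma card_freq_support q : is_policy q -> deterministic q ->
  #|[set i | freq M q i 0 != 0]| = #|constr N S|.
Proof.
(* The counting is done in R, where the indicators can be replaced by q. *)
move=> qP qD; apply/eqP; rewrite -(eqr_nat R) -sum1_card natr_sum big_mkcond /=.
rewrite (reindex_onto (@enum_rank (var N k)) enum_val) /=; last first.
  by move=> i _; rewrite enum_valK.
under eq_bigl do rewrite enum_rankK eqxx.
rewrite big_sumType /=.
rewrite [X in _ + X](_ : _ = S%:R); last first.
  transitivity (\sum_(s < S) (1 : R)); last by rewrite sumr_const card_ord.
  apply: eq_bigr => s _.
  rewrite inE freq_last // gt_eqF //.
  exact: (occupancy_gt0 qP ord_max s Mregular).
rewrite [X in X + _](_ : _ =
  \sum_(t < N.+1) \sum_(x : state_action k) q (t, x)).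
  under eq_bigr => t _ do rewrite sum_state_action.
  under eq_bigr => t _ do under eq_bigr => s _ do rewrite policy_sum1 //.
  rewrite !sumr_const !card_ord card_constr.
  by rewrite -mulrnA -mulrnDr addnC -mulnS.
rewrite pair_bigA; apply: eq_bigr => -[t x] _ /=.
rewrite inE freq_action // mulf_eq0 gt_eqF ?decision_occupancy_gt0 //=.
by rewrite [RHS]deterministicE //; case: eqP.
Qed.

Lemma deterministic_vertex q : is_policy q -> deterministic q ->
  vertex (in_P M) (freq M q).
Proof.
move=> qP qD; split=> [|y z l yP zP l0 l1 xyz]; first exact: freq_in_P.
have same y' : in_P M y' -> (forall i, freq M q i 0 = 0 -> y' i 0 = 0) ->
    y' = freq M q.
  move=> y'P y'0; have q'P := policy_of_policy y'P.
  rewrite -(policy_ofK y'P); congr freq; apply: eq_deterministic => //.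
  move=> [t [s a]] qa.
  have /eqP : xsa (freq M (policy_of y')) t a = 0.
    by rewrite policy_ofK //; apply: y'0; rewrite freq_action // qa mulr0.
  rewrite xsa_freq // mulf_eq0 gt_eqF ?decision_occupancy_gt0 //=.
  by move/eqP.
have [[y0 _ _ _] [z0 _ _ _]] := (yP, zP).
have yz0 i : freq M q i 0 = 0 -> y i 0 = 0 /\ z i 0 = 0.
  by rewrite xyz !mxE; apply: conv_comb_eq0.
by split; apply: same => // i /yz0 [].
Qed.

(** With [d] deterministic and [c * d <= q], the frequencies satisfy
    [l * freq M d <= x] for [l] a power of [c].  The rest of [x], rescaled, is the
    second endpoint [z] of a segment of [P] through [x] that starts at
    [freq M d]. *)
Lemma vertex_deterministic x : vertex (in_P M) x -> deterministic (policy_of x).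
Proof.
case=> xP ext; have qP := policy_of_policy xP.
have [d [c [dP dD c0 c1 cq]]] := dominated_deterministic qP.
have occ n s := occupancy_dominated n s dP (ltW c0) cq.
(* A frequency at epoch t involves at most t + 1 comparisons of d with q, one for
   each decision up to t: the exponent N.+1 serves all epochs. *)
have cX n : (n <= N.+1)%N -> c ^+ N.+1 <= c ^+ n.
  by move=> nN; rewrite ler_wiXn2l // ltW.
set l := c ^+ N.+1 in cX; have l0 : 0 < l by rewrite exprn_gt0.
have l1 : l < 1 by rewrite exprn_ilt1 // ltW.
have yx i : l * freq M d i 0 <= x i 0.
  rewrite -(policy_ofK xP) -[i]enum_valK; case: (enum_val i) => [[t a]|s].
    rewrite !freq_action //.
    apply: (@le_trans _ _
      (c ^+ t.+1 * (occupancy M d t (tag a) * d (t, a)))).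
      rewrite ler_wpM2r ?mulr_ge0 ?occupancy_ge0 ?policy_ge0 //.
      exact: cX (ltn_ord t).
    rewrite exprSr mulrACA.
    by rewrite ler_pM ?mulr_ge0 ?exprn_ge0 ?occupancy_ge0 ?policy_ge0 ?(ltW c0).
  rewrite !freq_last //; apply: le_trans (occ _ _).
  by rewrite ler_wpM2r ?occupancy_ge0 // cX.
pose z := (1 - l)^-1 *: (x - l *: freq M d).
have l1' : 1 - l != 0 by rewrite subr_eq0 gt_eqF.
have zP : in_P M z.
  apply/in_P_lp; have /in_P_lp [Ax _] := xP.
  have /in_P_lp [Ay _] := freq_in_P dP; split.
    rewrite -scalemxAr mulmxBr -scalemxAr Ax Ay -{1}[lp_rhs M]scale1r -scalerBl.
    by rewrite scalerA mulVf ?scale1r.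
  move=> i; rewrite !mxE mulr_ge0 ?invr_ge0 ?subr_ge0 ?(ltW l1) //.
  by have := yx i; rewrite mxE.
have [|<- _] := ext _ z l (freq_in_P dP) zP l0 l1.
  by rewrite scalerA divff // scale1r addrC subrK.
by rewrite freqK.
Qed.

Lemma deterministic_bfs q : is_policy q -> deterministic q ->
  basic_feasible_solution (lp_mx M) (lp_rhs M) (freq M q).
Proof.
move=> qP qD; apply: nondegenerate_vertex_bfs; last exact: card_freq_support.
by apply/vertex_in_P/deterministic_vertex.
Qed.

End Correspondence.

Theorem corollary5p6 (R : realFieldType) (N S : nat) (k : 'I_S -> nat)
    (M : vmdp R N k) (Mregular : regular M) :
  [/\ (forall x, in_P M x -> is_policy (policy_of x)),
      (forall q, is_policy q -> in_P M (freq M q)),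
      (forall x, in_P M x -> freq M (policy_of x) = x)
    & (forall q, is_policy q -> policy_of (freq M q) = q)] /\
  [/\ (forall x, vertex (in_P M) x <->
                 basic_feasible_solution (lp_mx M) (lp_rhs M) x),
      (forall x, vertex (in_P M) x -> deterministic (policy_of x)),
      (forall x, basic_feasible_solution (lp_mx M) (lp_rhs M) x ->
                 deterministic (policy_of x))
    & (forall q, is_policy q -> deterministic q ->
                 basic_feasible_solution (lp_mx M) (lp_rhs M) (freq M q))].
Proof.
have bfs_vtx x : basic_feasible_solution (lp_mx M) (lp_rhs M) x ->
  vertex (in_P M) x by move=> /bfs_vertex /vertex_in_P.
split; split.
- exact: policy_of_policy.
- exact: freq_in_P.
- exact: policy_ofK.
- exact: freqK.
- move=> x; split=> [xV|/bfs_vtx //].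
  rewrite -(policy_ofK xV.1); apply: deterministic_bfs => //.
    exact: policy_of_policy xV.1.
  exact: (vertex_deterministic Mregular xV).
- by move=> x xV; apply: (vertex_deterministic Mregular xV).
- by move=> x /bfs_vtx xV; apply: (vertex_deterministic Mregular xV).
exact: deterministic_bfs.
Qed.
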